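(* Let $\kappa \geq \omega$ be a cardinal. If there is a $\kappa^{+}$-Suslin tree, then $$\kappa^{+} \not\rightarrow \left( \kappa^{+}, \log_{\kappa}(\kappa^{+}) + 2 \right)^{2}.$$
   Context: For a cardinal $\kappa \geq \omega$, $\log_{\kappa}(\kappa^{+}) = \min\{\lambda : \kappa^{\lambda} > \kappa\}$, and $\log_{\kappa}(\kappa^{+}) + 2$ denotes ordinal addition. A $\kappa^{+}$-Suslin tree is a tree of size $\kappa^{+}$ with no chains and no antichains of size $\kappa^{+}$. For ordinals $\alpha,\beta,\gamma$, $\alpha \rightarrow (\beta,\gamma)^2$ means: for every $c : [\alpha]^2 \to 2$ (where $[\alpha]^2$ is the set of unordered pairs from $\alpha$) either there is $X \subset \alpha$ of order type $\beta$ with $c(\{x,y\})=0$ for all distinct $x,y \in X$, or there is $X \subset \alpha$ of order type $\gamma$ with $c(\{x,y\}) = 1$ for all distinct $x,y\in X$. $\not\rightarrow$ denotes the negation. *)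

(* Defs.v *)
From mathcomp Require Import all_boot all_order.
From mathcomp Require Import boolp classical_sets functions cardinality wochoice.

Set Implicit Arguments.
Unset Strict Implicit.
Unset Printing Implicit Defensive.

Local Open Scope classical_set_scope.
Local Open Scope card_scope.

(* Ordinals are represented by well-ordered types, with order isomorphism
   playing the role of equality; every notion below is invariant under it. *)
Record wotype := WOType {
  wo_sort :> Type;
  wo_le : rel wo_sort;
  wo_leP : well_order wo_le
}.

Definition wo_lt (A : wotype) (x y : A) : bool := ~~ wo_le y x.

Definition has_order_type (A : wotype) (X : set A) (B : wotype) : Prop :=
  exists f : B -> A, {mono f : x y / wo_le x y} /\ range f = X.

Lemma wo_ord_subproof (n : nat) : well_order (fun i j : 'I_n => (i <= j)%N).
Proof.
apply: antisymmetric_well_order => [i j /anti_leq/val_inj //|A [i Ai]].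
by case: (arg_minnP (fun j : 'I_n => nat_of_ord j) Ai) => j Aj jmin; exists j.
Qed.

Definition wo_ord (n : nat) : wotype := WOType (@wo_ord_subproof n).

(* Every element of A lies below every element of B. *)
Definition sum_le (A B : Type) (leA : rel A) (leB : rel B) : rel (A + B) :=
  fun u v => match u, v with
  | inl x, inl y => leA x y
  | inl _, inr _ => true
  | inr _, inl _ => false
  | inr x, inr y => leB x y
  end.

Lemma wo_add_subproof (A B : wotype) :
  well_order (sum_le (@wo_le A) (@wo_le B)).
Proof.
move=> P [u0 Pu0].
have [[x Px]|PNl] := pselect (exists x : A, inl x \in P).
  have [|z [[Pz zmin] zuniq]] := @wo_leP A [pred x | inl x \in P]; first by exists x.
  exists (inl z); split; first by split=> // -[y /zmin|].
  move=> [y|y] [Py ymin]; last by have := ymin _ Px.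
  by congr inl; apply: zuniq; split=> // t /ymin.
have Pinl x : inl x \in P -> False by move=> Px; apply: PNl; exists x.
have [|z [[Pz zmin] zuniq]] := @wo_leP B [pred x | inr x \in P].
  by case: u0 Pu0 => [x /Pinl|x Px] //; exists x.
exists (inr z); split; first by split=> // -[y /Pinl|y /zmin].
move=> [y|y] [Py ymin]; first by case: (Pinl _ Py).
by congr inr; apply: zuniq; split=> // t /ymin.
Qed.

Definition wo_add (A B : wotype) : wotype := WOType (@wo_add_subproof A B).

Definition card_lt (T U : Type) (A : set T) (B : set U) : Prop :=
  (A #<= B) /\ ~ (B #<= A).

(* Cardinals are the initial ordinals: those whose proper initial segments
   all have strictly smaller cardinality. *)
Definition is_cardinal (A : wotype) : Prop :=
  forall x : A, card_lt [set y | wo_lt y x] [set: A].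

Definition is_least_cardinal (P : wotype -> Prop) (A : wotype) : Prop :=
  [/\ is_cardinal A, P A &
      forall B : wotype, is_cardinal B -> P B -> [set: A] #<= [set: B]].

Definition is_succ_cardinal (kappa : wotype) : wotype -> Prop :=
  is_least_cardinal (fun mu => card_lt [set: kappa] [set: mu]).

(* log_kappa (kappa^+) *)
Definition is_log_succ (kappa : wotype) : wotype -> Prop :=
  is_least_cardinal (fun lambda => card_lt [set: kappa] [set: lambda -> kappa]).

Definition is_tree (d : Order.disp_t) (T : porderType d) : Prop :=
  forall t : T, wo_chain <=%O [pred s : T | (s < t)%O].

Definition antichain (d : Order.disp_t) (T : porderType d) (A : {pred T}) :=
  {in A &, forall x y : T, (x >=< y)%O -> x = y}.

Definition suslin_tree (mu : wotype) (d : Order.disp_t) (T : porderType d) :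
    Prop :=
  [/\ is_tree T,
      [set: T] #= [set: mu],
      (forall C : {pred T}, chain <=%O C -> ~ ([set` C] #= [set: mu])) &
      (forall A : {pred T}, antichain A -> ~ ([set` A] #= [set: mu]))].

Definition upair (T : Type) : Type :=
  {p : set T | exists x y : T, x <> y /\ p = [set x; y]}.

Definition homogeneous (T : Type) (c : upair T -> bool) (X : set T) (i : bool) :
    Prop :=
  forall p : upair T, sval p `<=` X -> c p = i.

(* alpha -> (beta, gamma)^2, with colours 0 and 1 encoded by false and true *)
Definition arrows (alpha beta gamma : wotype) : Prop :=
  forall c : upair alpha -> bool,
    (exists X : set alpha, has_order_type X beta /\ homogeneous c X false) \/
    (exists X : set alpha, has_order_type X gamma /\ homogeneous c X true).

(* Main.v *)
(* Write [S] for the elements of a Suslin tree that have [kappa^+] extensions.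
   Above every [s] in [S] there is an antichain [a s i] indexed by [kappa].
   Fix [kappa^+] distinct functions [F x : lambda -> kappa] and recall that
   [kappa^{<lambda} = kappa], so that restrictions of the [F x] to proper
   initial segments of [lambda] are coded by elements of [kappa]. The points
   of [kappa^+] are identified with nodes, and [x < y] get colour 1 if the
   first difference [delta] of [F x] and [F y] is such that [y] lies above the
   member of the antichain of [x] indexed by the code of [F y] restricted to
   [{eps | eps <= delta}].
   If [x < y < z] is homogeneous of colour 1, the antichain of [x] forces
   [F y] and [F z] to agree up to the first difference of [F x] and [F y]; along
   a homogeneous set of type [lambda + 2] the first differences would thus
   increase strictly for [lambda + 1] steps inside [lambda].
   If [X] has size [kappa^+], then outside a set of size [kappa] every [s] in
   [X] is such that, for each code [k] of some [t > s] in [X], the nodes of [X]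
   with code [k] are dense above [s], in particular above [a s k]; this gives
   a pair of colour 1. *)
Require Import Defs.
From mathcomp Require Import all_boot all_order.
From mathcomp Require Import boolp classical_sets functions cardinality wochoice.

Set Implicit Arguments.
Unset Strict Implicit.
Unset Printing Implicit Defensive.

Local Open Scope classical_set_scope.
Local Open Scope card_scope.

(** * Cardinal comparison and well-orders *)

(** Choosing an [R]-image for each point gives an injection; comparisons can thus be proved with
    relations on the ambient types instead of functions on subtypes. *)
Lemma card_le_rel (T U : Type) (A : set T) (B : set U) (R : T -> U -> Prop) :
  (forall x, A x -> exists y, B y /\ R x y) ->
  (forall x x' y, A x -> A x' -> R x y -> R x' y -> x = x') ->
  A #<= B.
Proof.
move=> Rtot Rinj.
have /choice[f Rf] (x : A) : exists y : B, R (val x) (val y).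
  case: x => x /= /set_mem/Rtot[y [By Rxy]].
  by exists (exist _ y (mem_set By)).
apply/card_leP/injfunPex; exists f => // x x' _ _ ffE.
apply: val_inj; apply: (Rinj _ _ (val (f x))); [exact: set_valP|exact: set_valP|exact: Rf|].
by rewrite ffE.
Qed.

Lemma card_leE (T U : Type) (A : set T) (B : set U) : A #<= B ->
  exists R : T -> U -> Prop,
  [/\ forall x, A x -> exists y, B y /\ R x y,
      forall x y y', R x y -> R x y' -> y = y' &
      forall x x' y, R x y -> R x' y -> x = x'].
Proof.
move=> /card_leP/injfunPex[f _ finj].
exists (fun x y => exists a : A, val a = x /\ val (f a) = y); split.
- move=> x Ax; exists (val (f (exist _ x (mem_set Ax)))); split; first exact: set_valP.
  by exists (exist _ x (mem_set Ax)).
- by move=> _ y y' [a [<- <-]] [b [/val_inj-> <-]].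
- move=> x x' y [a [<- <-]] [b [<- /val_inj ffE]].
  by rewrite (finj b a _ _ ffE) // inE.
Qed.

Lemma card_le_fun (T U : Type) (A : set T) (u : U) : A #<= [set: U] ->
  exists f : T -> U, forall x y, A x -> A y -> f x = f y -> x = y.
Proof.
move=> /card_leE[R [Rtot Rfun Rinj]].
have /choice[f fP] x : exists y, A x -> R x y.
  have [Ax|nAx] := pselect (A x); last by exists u.
  by have [y [_ Rxy]] := Rtot _ Ax; exists y.
exists f => x y Ax Ay fE; apply: (Rinj _ _ (f x)); first exact: fP.
by rewrite fE; apply: fP.
Qed.

Lemma fun_card_le (T U : Type) (A : set T) (B : set U) (f : T -> U) :
  (forall x, A x -> B (f x)) ->
  (forall x y, A x -> A y -> f x = f y -> x = y) -> A #<= B.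
Proof.
move=> fAB finj; apply: (@card_le_rel _ _ _ _ (fun x y => f x = y)).
  by move=> x Ax; exists (f x); split=> //; apply: fAB.
by move=> x x' y Ax Ax' <- fE; apply: finj.
Qed.

(** Zorn's lemma gives a maximal graph of a partial injection; were it neither total on [A] nor onto
    [B], one more pair could be added. *)
Lemma card_le_total (T U : Type) (A : set T) (B : set U) :
  (A #<= B) \/ (B #<= A).
Proof.
pose P (G : set (T * U)) := (forall p, G p -> A p.1 /\ B p.2) /\
  (forall p q, G p -> G q -> p.1 = q.1 <-> p.2 = q.2).
have [F FP Ftot|G [[GAB Ginj] Gmax]] := @Zorn_bigcup _ P.
  split=> [p [G /FP[GP _] /GP //]|p q [G FG Gp] [H FH Hq]].
  have [GH|HG] := Ftot _ _ FG FH.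
    by have [_] := FP _ FH; apply => //; apply: GH.
  by have [_] := FP _ FG; apply => //; apply: HG.
have [tot|/existsNP[x /not_implyP[Ax nx]]] :=
  pselect (forall x, A x -> exists y, G (x, y)).
  left; apply: (@card_le_rel _ _ _ _ (fun x y => G (x, y))).
    by move=> x /tot[y Gxy]; exists y; split=> //; have [] := GAB _ Gxy.
  by move=> x x' y _ _ Gx Gx'; apply/(Ginj _ _ Gx Gx').
have [tot|/existsNP[y /not_implyP[By ny]]] :=
  pselect (forall y, B y -> exists x, G (x, y)).
  right; apply: (@card_le_rel _ _ _ _ (fun y x => G (x, y))).
    by move=> y /tot[z Gzy]; exists z; split=> //; have [] := GAB _ Gzy.
  by move=> b b' a _ _ Gb Gb'; apply/(Ginj _ _ Gb Gb').
case: (Gmax (G `|` [set (x, y)])).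
  split; first by move=> p Gp; left.
  by move=> sub; apply: nx; exists y; apply: sub; right.
split=> [p [/GAB //|-> //]|[a b] [c d]].
move=> [Gp|[-> ->]] [Gq|[-> ->]] //=.
- exact: (Ginj _ _ Gp Gq).
- split=> E; first by case: nx; exists b; rewrite -E.
  by case: ny; exists a; rewrite -E.
- split=> E; first by case: nx; exists d; rewrite E.
  by case: ny; exists c; rewrite E.
Qed.

Lemma card_lt_trans (T U V : Type) (A : set T) (B : set U) (C : set V) :
  card_lt A B -> B #<= C -> card_lt A C.
Proof.
move=> [AB nBA] BC; split; first exact: card_le_trans AB BC.
by move=> CA; apply: nBA; exact: card_le_trans BC CA.
Qed.

Lemma card_ltNge (T U : Type) (A : set T) (B : set U) :
  ~ (B #<= A) -> card_lt A B.
Proof. by move=> nBA; split=> //; have [] := card_le_total A B. Qed.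

(** The order laws are read off from the unique minima of sets of one, two or three elements. *)
Lemma wo_refl (A : wotype) (x : A) : wo_le x x.
Proof.
by have [|z [[/eqP-> zmin] _]] := @wo_leP A [pred y : {classic A} | y == x];
  [exists x; rewrite inE|apply: zmin; rewrite inE].
Qed.

Lemma wo_min (A : wotype) (P : set A) : P !=set0 ->
  exists x, P x /\ forall y, P y -> wo_le x y.
Proof.
move=> [x Px].
have [|z [[/asboolP Pz zmin] _]] := @wo_leP A [pred y | `[< P y >]].
  by exists x; apply/asboolP.
by exists z; split=> // y Py; apply: zmin; apply/asboolP.
Qed.

Lemma wo_anti (A : wotype) (x y : A) : wo_le x y -> wo_le y x -> x = y.
Proof.
move=> xy yx.
pose P : {pred A} := fun z => `[< z = x \/ z = y >].
have [|z [_ zuniq]] := @wo_leP A P; first by exists x; apply/asboolP; left.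
have <- : z = x.
  by apply: zuniq; split; [apply/asboolP; left|move=> t /asboolP[]-> //; apply: wo_refl].
apply: zuniq; split; [by apply/asboolP; right|].
by move=> t /asboolP[]-> //; apply: wo_refl.
Qed.

Lemma wo_total (A : wotype) (x y : A) : wo_le x y || wo_le y x.
Proof.
have [|z [zxy zmin]] := @wo_min A (fun z => z = x \/ z = y).
  by exists x; left.
apply/orP; case: zxy => zE; rewrite -zE.
  by left; apply: zmin; right.
by right; apply: zmin; left.
Qed.

Lemma wo_trans (A : wotype) (y x z : A) : wo_le x y -> wo_le y z -> wo_le x z.
Proof.
move=> xy yz.
have [|t [txyz tmin]] := @wo_min A (fun t => [\/ t = x, t = y | t = z]).
  by exists x; constructor.
have tx : wo_le t x by apply: tmin; constructor.
have ty : wo_le t y by apply: tmin; constructor.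
have tz : wo_le t z by apply: tmin; constructor.
case: txyz => tE; rewrite tE in tx ty tz => //.
  by rewrite (wo_anti xy tx).
by rewrite (wo_anti ty yz).
Qed.

Lemma wo_ltW (A : wotype) (x y : A) : wo_lt x y -> wo_le x y.
Proof. by move=> /negPf xy; have := wo_total x y; rewrite xy orbF. Qed.

Lemma wo_ltxx (A : wotype) (x : A) : ~ wo_lt x x.
Proof. by move=> /negP; apply; apply: wo_refl. Qed.

Lemma wo_leVlt (A : wotype) (x y : A) : wo_le x y \/ wo_lt y x.
Proof. by rewrite /wo_lt; case: (wo_le x y); [left|right]. Qed.

Lemma wo_lt_le_trans (A : wotype) (y x z : A) :
  wo_lt x y -> wo_le y z -> wo_lt x z.
Proof.
by move=> /negP xy yz; apply/negP => zx; apply: xy; exact: wo_trans yz zx.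
Qed.

Lemma wo_lt_trans (A : wotype) (y x z : A) :
  wo_lt x y -> wo_lt y z -> wo_lt x z.
Proof. by move=> xy /wo_ltW; apply: wo_lt_le_trans. Qed.

Lemma wo_lt_neq (A : wotype) (x y : A) : wo_lt x y -> x <> y.
Proof. by move=> xy E; move: xy; rewrite E => /wo_ltxx. Qed.

Lemma wo_neq_lt (A : wotype) (x y : A) : x <> y -> wo_lt x y \/ wo_lt y x.
Proof.
have [xy|yx] := wo_leVlt x y; last by right.
have [yx|] := wo_leVlt y x; last by left.
by case; apply: wo_anti.
Qed.

Lemma wo_lt_wf (A : wotype) : well_founded (fun x y : A => wo_lt x y).
Proof.
move=> x; apply: contrapT => nx.
have [|z [nz zmin]] := @wo_min A (fun z => ~ Acc (fun x y : A => wo_lt x y) z).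
  by exists x.
apply: nz; split=> y yz; apply: contrapT => /zmin; exact/negP.
Qed.

Lemma sub_wo_subproof (A : wotype) (X : set A) :
  well_order (fun x y : X => wo_le (val x) (val y)).
Proof.
apply: antisymmetric_well_order => [x y /andP[xy yx]|P [x Px]].
  by apply: val_inj; apply: wo_anti.
have [|_ [[z [Pz <-]] zmin]] := @wo_min A (fun a => exists x : X, x \in P /\ val x = a).
  by exists (val x), x.
by exists z; split=> // y Py; apply: zmin; exists y.
Qed.

Definition sub_wo (A : wotype) (X : set A) : wotype := WOType (@sub_wo_subproof A X).

(** Well-order [C]; if the result is not an initial ordinal, cut it at the least [x] whose initial
    segment is as large as the whole. *)
Lemma card_representative (T : Type) (C : set T) :
  exists B : wotype, is_cardinal B /\ ([set: B] #= C).
Proof.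
have [R Rwo] := well_ordering_principle {classic C}.
pose A := WOType Rwo.
have AC : [set: A] #= C := card_setT C.
have [cA|/existsNP[x0 nx0]] := pselect (is_cardinal A); first by exists A.
have [|x [nx xmin]] :=
  @wo_min A (fun x => ~ card_lt [set y | wo_lt y x] [set: A]); first by exists x0.
have leA (X : set A) : X #<= [set: A] by apply: subset_card_le.
have Ax : [set: A] #<= [set y | wo_lt y x].
  by apply: contrapT => nA; apply: nx; split.
pose X := [set y | wo_lt y x].
have BX : [set: sub_wo X] #= X := card_setT X.
exists (sub_wo X); split; last first.
  apply: card_eq_trans BX _; apply: card_eq_trans _ AC.
  by apply/card_eqPle; split.
move=> y; split; first by apply: subset_card_le.
move=> By.
have [_] : card_lt [set z | wo_lt z (val y)] [set: A].
  apply: contrapT => /xmin; apply/negP; exact: (set_valP y).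
apply; apply: card_le_trans Ax _; rewrite -(card_le_eql BX).
apply: card_le_trans By _.
by apply: (@fun_card_le _ _ _ _ val) => // a b _ _; apply: val_inj.
Qed.

Lemma least_cardinal_le (P : wotype -> Prop) (mu : wotype) (T : Type) (C : set T) :
  is_least_cardinal P mu ->
  (forall B : wotype, [set: B] #= C -> P B) -> [set: mu] #<= C.
Proof.
move=> [_ _ muP] CP; have [B [cB BC]] := card_representative C.
by rewrite -(card_le_eqr BC); apply: muP => //; apply: CP.
Qed.

(** * Squares of infinite cardinals *)

Section Square.
Variable K : Type.

Let dom (G : set (K * K * K)) : set K := [set x | exists y z, G (x, y, z)].

(** An injection of the square of [dom G] into [dom G], given by its graph so that Zorn's lemma for
    inclusion applies. *)
Definition pairing_graph (G : set (K * K * K)) : Prop :=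
  [/\ forall x y, dom G x -> dom G y -> exists z, G (x, y, z),
      forall x y z, G (x, y, z) -> [/\ dom G x, dom G y & dom G z],
      forall p z z', G (p, z) -> G (p, z') -> z = z' &
      forall p p' z, G (p, z) -> G (p', z) -> p = p'].

Lemma pairing_graph_bigcup (F : set (set (K * K * K))) :
  F `<=` pairing_graph -> total_on F subset ->
  pairing_graph (\bigcup_(X in F) X).
Proof.
move=> FP Ftot.
have join G H : F G -> F H -> exists2 J, F J & G `<=` J /\ H `<=` J.
  by move=> FG FH; have [GH|HG] := Ftot _ _ FG FH; [exists H|exists G] => //; split.
have domS G : F G -> dom G `<=` dom (\bigcup_(X in F) X).
  by move=> FG x [y [z Gxyz]]; exists y, z, G.
split.
- move=> x y [x1 [x2 [G FG Gx]]] [y1 [y2 [H FH Hy]]].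
  have [J FJ [GJ HJ]] := join _ _ FG FH; have [Jtot _ _ _] := FP _ FJ.
  have [||z Jz] := Jtot x y; last by exists z, J.
    by exists x1, x2; apply: GJ.
  by exists y1, y2; apply: HJ.
- move=> x y z [G FG Gxyz]; have [_ Gdom _ _] := FP _ FG.
  by have [? ? ?] := Gdom _ _ _ Gxyz; split; apply: (domS _ FG).
- move=> p z z' [G FG Gz] [H FH Hz].
  have [J FJ [GJ HJ]] := join _ _ FG FH; have [_ _ Jfun _] := FP _ FJ.
  by apply: (Jfun p); [apply: GJ|apply: HJ].
- move=> p p' z [G FG Gz] [H FH Hz].
  have [J FJ [GJ HJ]] := join _ _ FG FH; have [_ _ _ Jinj] := FP _ FJ.
  by apply: (Jinj _ _ z); [apply: GJ|apply: HJ].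
Qed.

(** Let [g] inject the domain [X] into its complement. The new domain [Y] is [X] together with its
    image under [g]; pairs from [Y] that are not pairs from [X] are sent into that image, away from
    the old values. *)
Lemma pairing_graph_extend (M : set (K * K * K)) (i0 i1 : K) :
  pairing_graph M -> dom M i0 -> dom M i1 -> i0 <> i1 ->
  dom M #<= ~` dom M ->
  exists2 M', pairing_graph M' & M `<` M'.
Proof.
move=> [Mtot Mdom Mfun Minj] Xi0 Xi1 i01 /card_leE[R [Rtot Rfun Rinj]].
set X := dom M in Rtot Xi0 Xi1 *.
have /choice[f fP] (p : K * K) : exists z, X p.1 -> X p.2 -> M (p, z).
  have [[X1 X2]|nX] := pselect (X p.1 /\ X p.2).
    by case: p X1 X2 => x y X1 X2; have [z Mz] := Mtot _ _ X1 X2; exists z.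
  by exists i0 => X1 X2; case: nX.
have fX x y : X x -> X y -> X (f (x, y)).
  by move=> Xx Xy; have [] := Mdom _ _ _ (fP (x, y) Xx Xy).
have finj x y x' y' : X x -> X y -> X x' -> X y' ->
    f (x, y) = f (x', y') -> x = x' /\ y = y'.
  move=> Xx Xy Xx' Xy' E.
  have M1 := fP (x, y) Xx Xy; have M2 := fP (x', y') Xx' Xy'.
  by rewrite E in M1; have [-> ->] := Minj _ _ _ M1 M2.
have /choice[g gP] x : exists y, X x -> ~ X y /\ R x y.
  have [/Rtot[y yP]|nX] := pselect (X x); first by exists y.
  by exists i0 => /nX.
have gX x : X x -> ~ X (g x) by move=> /gP[].
have ginj x y : X x -> X y -> g x = g y -> x = y.
  move=> /gP[_ Rx] /gP[_ Ry] E; apply: (Rinj _ _ (g x)) => //.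
  by rewrite E.
pose Y := X `|` g @` X.
(* [e] injects [Y] into [X]; the tags [i0] and [i1] keep the two halves of [Y] apart. *)
have /choice[e eP] (y : K) : exists z, (X y -> z = f (i0, y)) /\
    (forall x, X x -> y = g x -> z = f (i1, x)).
  have [Xy|nXy] := pselect (X y).
    by exists (f (i0, y)); split=> // x /gX nX yE; case: nX; rewrite -yE.
  have [[x Xx yE]|ng] := pselect (exists2 x, X x & y = g x).
    exists (f (i1, x)); split=> // x' Xx' yE'.
    by rewrite (ginj _ _ Xx Xx') // -yE.
  by exists i0; split=> // x Xx yE; case: ng; exists x.
have eX y : Y y -> X (e y).
  move=> [Xy|[x Xx <-]].
    by have [-> // _] := eP y; apply: fX.
  by have [_ /(_ x Xx erefl)->] := eP (g x); apply: fX.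
have einj y y' : Y y -> Y y' -> e y = e y' -> y = y'.
  move=> [Xy|[x Xx <-]] [Xy'|[x' Xx' <-]].
  - have [-> // _] := eP y; have [-> // _] := eP y'.
    by move=> /finj[].
  - have [-> // _] := eP y; have [_ /(_ _ Xx' erefl)->] := eP (g x').
    by move=> /finj[].
  - have [-> // _] := eP y'; have [_ /(_ _ Xx erefl)->] := eP (g x).
    by move=> /finj[]// /esym.
  - have [_ /(_ _ Xx erefl)->] := eP (g x); have [_ /(_ _ Xx' erefl)->] := eP (g x').
    by move=> /finj[]// _ ->.
pose N : set (K * K * K) := [set q | [/\ Y q.1.1, Y q.1.2,
  ~ (X q.1.1 /\ X q.1.2) & q.2 = g (f (e q.1.1, e q.1.2))]].
pose M' := M `|` N.
have MY x y z : M' (x, y, z) -> [/\ Y x, Y y & Y z].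
  case=> [/Mdom[]|[/= Yx Yy _ ->]]; first by split; left.
  by split=> //; right; eexists; last reflexivity; apply: fX; apply: eX.
have M'tot x y : Y x -> Y y -> exists z, M' (x, y, z).
  move=> Yx Yy; have [[Xx Xy]|nX] := pselect (X x /\ X y).
    by have [z Mz] := Mtot _ _ Xx Xy; exists z; left.
  by exists (g (f (e x, e y))); right.
have domM' : dom M' = Y.
  apply/seteqP; split=> [x [y [z /MY[]//]]|x Yx].
  by have [z Mz] := M'tot x x Yx Yx; exists x, z.
exists M'.
  rewrite /pairing_graph domM'; split=> //.
  - move=> [x y] z z' [Mz|[/= _ _ nX ->]] [Mz'|[/= _ _ nX' ->]] //.
    + exact: Mfun Mz Mz'.
    + by case: nX'; have [] := Mdom _ _ _ Mz.
    + by case: nX; have [] := Mdom _ _ _ Mz'.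
  - move=> [x y] [x' y'] z [Mz|[/= Yx Yy nX zE]] [Mz'|[/= Yx' Yy' nX' zE']] //.
    + exact: Minj Mz Mz'.
    + have [_ _ Xz] := Mdom _ _ _ Mz.
      by case: (gX _ (fX _ _ (eX _ Yx') (eX _ Yy'))); rewrite -zE'.
    + have [_ _ Xz] := Mdom _ _ _ Mz'.
      by case: (gX _ (fX _ _ (eX _ Yx) (eX _ Yy))); rewrite -zE.
    + move: zE; rewrite zE' => /ginj /finj[]; try by do ?apply: fX; apply: eX.
      by move=> /einj-> // /einj->.
split; first by move=> q Mq; left.
have Yg : Y (g i0) by right; exists i0.
have [z M'z] := M'tot _ _ Yg Yg.
by move=> /(_ _ M'z) /Mdom[+ _ _]; apply: gX.
Qed.

(** By [pairing_graph_extend], the domain of a maximal pairing graph is at least as large as its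
    complement; hence all of [K] injects into the domain, where pairs can be coded. *)
Lemma card_square : [set: nat] #<= [set: K] -> [set: K * K] #<= [set: K].
Proof.
move=> natK.
have [_ [/(_ 0 I)[k0 _] _ _]] := card_leE natK.
have [i iinj] : exists i : nat -> K, injective i.
  have [i iP] := card_le_fun k0 natK.
  by exists i => x y; apply: iP.
have /card_eqPle[/(card_le_fun 0)[c cinj] _] := card_nat2.
pose G0 : set (K * K * K) :=
  [set q | exists m n, q = (i m, i n, i (c (m, n)))].
have domG0 x : dom G0 x <-> exists n, x = i n.
  split=> [[y [z [m [n [-> _ _]]]]]|[n ->]]; first by exists m.
  by exists (i n), (i (c (n, n))), n, n.
have PG0 : pairing_graph G0.
  split.
  - move=> x y /domG0[m ->] /domG0[n ->].
    by exists (i (c (m, n))), m, n.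
  - move=> x y z [m [n [-> -> ->]]].
    by split; apply/domG0; eexists.
  - by move=> p z z' [m [n [-> ->]]] [m' [n' [/iinj-> /iinj-> ->]]].
  - by move=> p p' z [m [n [-> ->]]] [m' [n' [-> /iinj/(cinj _ _ I I)[-> ->]]]].
(* Adjoining [G0] makes the union of the empty chain admissible and puts a copy of [nat] into the
   domain. *)
have [F FP Ftot|G [PG Gmax]] :=
    @Zorn_bigcup _ (fun G => pairing_graph (G `|` G0)).
  have [[G1 FG1]|nF] := pselect (exists G, F G); last first.
    suff -> : \bigcup_(X in F) X = set0 by rewrite set0U.
    by apply/seteqP; split=> // q [G FG _]; case: nF; exists G.
  have -> : (\bigcup_(X in F) X) `|` G0 =
      \bigcup_(X in [set X `|` G0 | X in F]) X.
    apply/seteqP; split=> [q [[G FG Gq]|Gq]|q [_ [G FG <-]] [Gq|Gq]].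
    - by exists (G `|` G0); [exists G|left].
    - by exists (G1 `|` G0); [exists G1|right].
    - by left; exists G.
    - by right.
  apply: pairing_graph_bigcup => [_ [G /FP FG <-] //|].
  move=> _ _ [G FG <-] [H FH <-].
  by have [s|s] := Ftot _ _ FG FH; [left|right]; apply: setSU.
set M := G `|` G0 in PG.
have Xi n : dom M (i n).
  by exists (i n), (i (c (n, n))); right; exists n, n.
have i01 : i 0 <> i 1 by move=> /iinj.
have [lt|nle] := pselect (dom M #<= ~` dom M).
  have [M' PM' [MM' nM'M]] := pairing_graph_extend PG (Xi 0) (Xi 1) i01 lt.
  case: (Gmax M'); first split=> [q Gq|sub].
  - by apply: MM'; left.
  - by apply: nM'M => q /sub; left.
  suff -> : M' `|` G0 = M' by [].
  by apply/setUidPl => q Gq; apply: MM'; right.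
have {}nle : ~` dom M #<= dom M.
  by have [|] := card_le_total (dom M) (~` dom M).
have [Mtot Mdom Mfun Minj] := PG.
have /choice[f fP] (p : K * K) :
    exists z, dom M p.1 -> dom M p.2 -> M (p, z).
  have [[X1 X2]|nX] := pselect (dom M p.1 /\ dom M p.2).
    by case: p X1 X2 => x y X1 X2; have [z Mz] := Mtot _ _ X1 X2; exists z.
  by exists k0 => X1 X2; case: nX.
have fX x y : dom M x -> dom M y -> dom M (f (x, y)).
  by move=> Xx Xy; have [] := Mdom _ _ _ (fP (x, y) Xx Xy).
have finj x y x' y' : dom M x -> dom M y -> dom M x' -> dom M y' ->
    f (x, y) = f (x', y') -> x = x' /\ y = y'.
  move=> Xx Xy Xx' Xy' E.
  have M1 := fP (x, y) Xx Xy; have M2 := fP (x', y') Xx' Xy'.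
  by rewrite E in M1; have [-> ->] := Minj _ _ _ M1 M2.
have [R [Rtot _ Rinj]] := card_leE nle.
have /choice[h hP] x : exists y, ~ dom M x -> dom M y /\ R x y.
  have [X|/Rtot[y yP]] := pselect (dom M x); first by exists k0.
  by exists y.
(* The tags [i 0] and [i 1] separate the domain from its complement. *)
pose k x := if pselect (dom M x) then f (i 0, x) else f (i 1, h x).
have kX x : dom M (k x).
  by rewrite /k; case: pselect => [X|nX]; apply: fX => //; have [] := hP _ nX.
have kinj : injective k.
  move=> x y; rewrite /k.
  case: pselect => [Xx|nXx]; case: pselect => [Xy|nXy];
    try have [Xhx Rx] := hP _ nXx; try have [Xhy Ry] := hP _ nXy; move=> /finj[] //.
  - by move=> /esym.
  - by move=> _ E; apply: (Rinj _ _ (h x)) => //; rewrite E.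
apply: (@fun_card_le _ _ _ _ (fun p => f (k p.1, k p.2))) => //.
by move=> [x y] [x' y'] _ _ /= /finj[]// /kinj-> /kinj->.
Qed.

End Square.

(** * Successor and logarithm of an infinite cardinal *)

Lemma card_le_pow (M N K : Type) : [set: M] #<= [set: N] -> K ->
  [set: M -> K] #<= [set: N -> K].
Proof.
move=> /card_leE[R [Rtot _ Rinj]] k0.
apply: (@card_le_rel _ _ _ _ (fun f h => forall m n, R m n -> h n = f m)).
  move=> f _.
  have /choice[h hP] n : exists k, forall m, R m n -> k = f m.
    have [[m Rmn]|nR] := pselect (exists m, R m n).
      by exists (f m) => m' Rm'n; rewrite (Rinj _ _ _ Rmn Rm'n).
    by exists k0 => m Rmn; case: nR; exists m.
  by exists h; split=> // m n; apply: hP.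
move=> f f' h _ _ fh f'h; apply/funext => m.
by have [n [_ Rmn]] := Rtot m I; rewrite -(fh _ _ Rmn) -(f'h _ _ Rmn).
Qed.

Section InfiniteCardinal.
Variable K : Type.
Hypothesis natK : [set: nat] #<= [set: K].

Lemma infinite_inhabited : exists k0 k1 : K, k0 <> k1.
Proof.
have [_ [/(_ 0 I)[k0 _] _ _]] := card_leE natK.
have [i iinj] := card_le_fun k0 natK.
by exists (i 0), (i 1) => /(iinj _ _ I I).
Qed.

(** Cantor's diagonal argument: given an injection [F] into [K], the function [g] differs from each
    [h] at the point [F h]. *)
Lemma card_lt_fun_self : card_lt [set: K] [set: K -> K].
Proof.
have [k0 [k1 k01]] := infinite_inhabited.
apply: card_ltNge => /(card_le_fun k0)[F Finj].
have /choice[g gP] k : exists z, forall h, F h = k -> z <> h k.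
  have [[h Fh]|nF] := pselect (exists h, F h = k); last first.
    by exists k0 => h Fh; case: nF; exists h.
  have hE h' : F h' = k -> h' = h.
    by move=> Fh'; apply: Finj => //; rewrite Fh'.
  have [hk|hk] := pselect (h k = k0); last by exists k0 => h' /hE-> /esym.
  by exists k1 => h' /hE->; rewrite hk => /esym.
exact: (gP (F g) g erefl).
Qed.

(** A point is coded by an index [i] and its code inside [F i]; using a relation leaves the choice
    of [i] open. *)
Lemma card_le_bigcup (I T : Type) (D : set I) (F : I -> set T) :
  D #<= [set: K] -> (forall i, D i -> F i #<= [set: K]) ->
  \bigcup_(i in D) F i #<= [set: K].
Proof.
move=> DK FK; apply: card_le_trans (card_square natK).
have [k0 _] := infinite_inhabited.
have [e einj] := card_le_fun k0 DK.
have /choice[f fP] i : exists f : T -> K,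
    D i -> forall x y, F i x -> F i y -> f x = f y -> x = y.
  have [Di|nDi] := pselect (D i); last by exists (fun=> k0).
  by have [f fP] := card_le_fun k0 (FK _ Di); exists f.
apply: (@card_le_rel _ _ _ _
  (fun x p => exists i, [/\ D i, F i x & p = (e i, f i x)])).
  by move=> x [i Di Fix]; exists (e i, f i x); split=> //; exists i.
move=> x y p _ _ [i [Di Fx ->]] [j [Dj Fy []]] /(einj _ _ Di Dj) ij.
by rewrite -ij in Fy *; apply: fP.
Qed.

Lemma card_le_setU (T : Type) (A B : set T) :
  A #<= [set: K] -> B #<= [set: K] -> A `|` B #<= [set: K].
Proof.
move=> AK BK; have -> : A `|` B = \bigcup_(b in [set: bool]) if b then A else B.
  apply/seteqP; split=> [x [Ax|Bx]|x [[] _ xP]]; [|by exists false|by left|by right].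
  by exists true.
apply: card_le_bigcup => [|[]//].
apply: card_le_trans natK.
by apply: (@fun_card_le _ _ _ _ nat_of_bool) => // -[] [].
Qed.

End InfiniteCardinal.

Section SuccessorAndLog.
Variables kappa kappa_succ lambda : wotype.
Hypothesis kappa_inf : [set: nat] #<= [set: kappa].
Hypothesis kappa_succP : is_succ_cardinal kappa kappa_succ.
Hypothesis lambdaP : is_log_succ kappa lambda.

Lemma succ_card_le (T : Type) (C : set T) :
  ~ (C #<= [set: kappa]) -> [set: kappa_succ] #<= C.
Proof.
move=> nC; apply: (least_cardinal_le kappa_succP) => B BC.
by apply: card_ltNge; rewrite (card_le_eql BC).
Qed.

Lemma succ_not_le : ~ ([set: kappa_succ] #<= [set: kappa]).
Proof. by have [_ []] := kappa_succP. Qed.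

Lemma succ_segment_le (x : kappa_succ) : [set y | wo_lt y x] #<= [set: kappa].
Proof.
apply: contrapT => /succ_card_le le; have [cS _ _] := kappa_succP.
by have [_] := cS x.
Qed.

Lemma succ_le_functions : [set: kappa_succ] #<= [set: lambda -> kappa].
Proof. by apply: succ_card_le; have [_ []] := lambdaP. Qed.

(** Otherwise the cardinality of [M] would compete in the minimum that defines [lambda]. *)
Lemma log_power_le (M : Type) : ~ ([set: lambda] #<= [set: M]) ->
  [set: M -> kappa] #<= [set: kappa].
Proof.
move=> nle; apply: contrapT => nK; apply: nle.
have [k0 _] := infinite_inhabited kappa_inf.
apply: (least_cardinal_le lambdaP) => B /card_eqPle[_ MB].
apply: card_ltNge => BK; apply: nK; apply: card_le_trans BK.
exact: card_le_pow.
Qed.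

(** By Cantor's theorem [kappa] itself competes in the minimum that defines [lambda]. *)
Lemma log_le : [set: lambda] #<= [set: kappa].
Proof.
have [k0 _] := infinite_inhabited kappa_inf.
apply: (least_cardinal_le lambdaP) => B /card_eqPle[_ KB].
apply: card_lt_trans (card_lt_fun_self kappa_inf) _.
exact: card_le_pow.
Qed.

(* This is the identity [kappa^{<lambda} = kappa]: codes stand for the
   functions on initial segments [{eps | eps <= delta}] of [lambda]. *)
Lemma restriction_code : exists code : lambda -> (lambda -> kappa) -> kappa,
  forall delta delta' f f', code delta f = code delta' f' <->
    delta = delta' /\ forall eps, wo_le eps delta -> f eps = f' eps.
Proof.
have [k0 _] := infinite_inhabited kappa_inf.
have [l linj] := card_le_fun k0 log_le.
have [c cinj] := card_le_fun k0 (card_square kappa_inf).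
pose M delta : Type := [set eps : lambda | wo_lt eps delta].
have r delta : {r : (M delta -> kappa) -> kappa | injective r}.
  have [|r rinj] := cid (card_le_fun k0 (@log_power_le (M delta) _)).
    have [clam _ _] := lambdaP; have [_ nle] := clam delta.
    by rewrite (card_le_eqr (card_setT _)).
  by exists r => f g; apply: rinj.
(* [log_power_le] covers the open segment below [delta], which is smaller than the cardinal
   [lambda]; the value at [delta] is paired on separately. *)
exists (fun delta f => c (l delta, c (sval (r delta) (f \o val), f delta))).
move=> delta delta' f f'; split=> [|[<- ff']].
  move=> /(cinj _ _ I I)[/(linj _ _ I I) E]; case: _ / E.
  move=> /(cinj _ _ I I)[/(svalP (r delta)) rE dE]; split=> // eps.
  have [->//|/wo_neq_lt[lt _|/negP//]] := pselect (eps = delta).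
  have := congr1 (fun h : M delta -> kappa => h (exist _ eps (mem_set lt))) rE.
  by [].
congr (c (_, c (sval _ _, _))); last by apply: ff'; apply: wo_refl.
by apply/funext => -[eps /= /set_mem/wo_ltW/ff'].
Qed.

End SuccessorAndLog.

(** * Trees without large chains and antichains *)

(** Transfinite recursion for the stages in [heavy_wide], each depending only on the union of the
    earlier ones. *)
Lemma wo_set_rec (A : wotype) (T : Type) (step : set T -> set T) :
  exists B : A -> set T,
    forall x, B x = step (\bigcup_(y in [set y | wo_lt y x]) B y).
Proof.
pose body x (rec : forall y : A, wo_lt y x -> set T) : set T :=
  step [set t | exists y (yx : wo_lt y x), rec y yx t].
exists (Fix (@wo_lt_wf A) _ body) => x.
rewrite Fix_eq => [|{}x f g fg].
  congr step; apply/seteqP; split=> [t [y [yx Bt]]|t [y yx Bt]]; first by exists y.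
  by exists y, yx.
congr step; apply/seteqP.
by split=> t [y [yx Bt]]; exists y, yx; [rewrite -fg|rewrite fg].
Qed.

(** At the least [z] with [f z] below [z], the point [f z] would be a smaller counterexample. *)
Lemma wo_homo_ge (A : wotype) (f : A -> A) :
  (forall x y, wo_lt x y -> wo_lt (f x) (f y)) -> forall x, wo_le x (f x).
Proof.
move=> fhomo x; apply: contrapT => nx.
have [|z [/negP zf zmin]] := @wo_min A (fun z => ~ wo_le z (f z)); first by exists x.
by have /zmin : ~ wo_le (f z) (f (f z)); [exact/negP/fhomo|exact/negP].
Qed.

Section ThinTree.
Variables (kappa : wotype) (d : Order.disp_t) (T : porderType d).
Hypothesis kappa_inf : [set: nat] #<= [set: kappa].
Hypothesis T_tree : is_tree T.
Hypothesis chain_le : forall C : set T,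
  (forall x y, C x -> C y -> (x <= y)%O \/ (y <= x)%O) -> C #<= [set: kappa].
Hypothesis antichain_le : forall A : set T,
  (forall x y, A x -> A y -> (x <= y)%O -> x = y) -> A #<= [set: kappa].

Local Notation small A := (A #<= [set: kappa]).

Definition above (x : T) : set T := [set y | (x <= y)%O].

Definition below (x : T) : set T := [set y | (y <= x)%O].

Definition heavy (x : T) : Prop := ~ small (above x).

Definition minimals (P : set T) : set T :=
  [set m | P m /\ forall x, P x -> (x <= m)%O -> x = m].

(** Either [t] is minimal in [P], or the well-ordered set of predecessors of [t] that lie in [P] has
    a least element. *)
Lemma tree_min (P : set T) : P !=set0 -> minimals P !=set0.
Proof.
move=> [t Pt].
have [[s Ps st]|nP] := pselect (exists2 s, P s & (s < t)%O); last first.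
  exists t; split=> // x Px xt; apply/eqP; apply: contrapT => /negP xDt.
  by apply: nP; exists x; rewrite // Order.POrderTheory.lt_neqAle xDt.
have [||z [[zP zmin] _]] := @T_tree t [pred s | (s < t)%O && `[< P s >]].
- by move=> x /andP[].
- by exists s; rewrite inE st; apply/asboolP.
move: zP; rewrite inE => /andP[zt /asboolP Pz].
exists z; split=> // x Px xz; apply: Order.POrderTheory.le_anti.
rewrite xz; apply: zmin; rewrite inE; apply/andP; split; last exact/asboolP.
exact: Order.POrderTheory.le_lt_trans zt.
Qed.

Lemma minimals_le (P : set T) : small (minimals P).
Proof. by apply: antichain_le => x y [Px _] [_ ymin] /(ymin _ Px). Qed.

Lemma minimals_below (P : set T) (x : T) :
  P x -> exists2 m, minimals P m & (m <= x)%O.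
Proof.
move=> Px; have [|m [[Pm mx] mmin]] := @tree_min (P `&` below x).
  by exists x; split=> //; apply: Order.POrderTheory.lexx.
exists m => //; split=> // y Py ym; apply: mmin => //; split=> //.
exact: Order.POrderTheory.le_trans ym mx.
Qed.

Lemma tree_comparable (t x y : T) :
  (x <= t)%O -> (y <= t)%O -> (x <= y)%O \/ (y <= x)%O.
Proof.
rewrite !Order.POrderTheory.le_eqVlt => /predU1P[->|xt] /predU1P[->|yt].
- by left; rewrite eqxx.
- by right; rewrite yt orbT.
- by left; rewrite xt orbT.
- by rewrite -!Order.POrderTheory.le_eqVlt; apply/orP/(wo_chainW (@T_tree t)).
Qed.

Lemma below_le (t : T) : small (below t).
Proof. by apply: chain_le => x y; apply: tree_comparable. Qed.

Lemma down_closure_le (Y : set T) :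
  small Y -> small (\bigcup_(y in Y) below y).
Proof. by move=> Yle; apply: card_le_bigcup => // y _; apply: below_le. Qed.

(** Every such node lies above a minimal one; the minimal ones form an antichain, and each has at
    most [kappa] members of [Z] above it. *)
Lemma light_le (Z : set T) : small (Z `&` [set t | small (Z `&` above t)]).
Proof.
set L := _ `&` _.
apply: (@card_le_trans _ _ _ (\bigcup_(m in minimals L) (Z `&` above m))).
  by apply: subset_card_le => t Lt; have [m mL mt] := minimals_below Lt;
    exists m => //; split=> //; case: Lt.
apply: card_le_bigcup => //; first exact: minimals_le.
by move=> m [[]].
Qed.

Lemma heavy_setC_le : small (~` [set s | heavy s]).
Proof.
apply: card_le_trans (light_le setT); apply: subset_card_le => t /= /contrapT.
by rewrite setTI.
Qed.

Lemma heavy_above (s : T) : heavy s -> ~ small (above s `&` [set t | heavy t]).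
Proof.
move=> hs le; apply: hs.
apply: card_le_trans (card_le_setU kappa_inf le heavy_setC_le).
apply: subset_card_le => t st.
by have [ht|nht] := pselect (heavy t); [left|right].
Qed.

(** Otherwise the heavy nodes above [s] would form a chain larger than [kappa]. *)
Lemma heavy_split (s : T) : heavy s -> exists p : T * T,
  [/\ (s <= p.1)%O, (s <= p.2)%O & ~ ((p.1 <= p.2)%O \/ (p.2 <= p.1)%O)].
Proof.
move=> /heavy_above nle; apply: contrapT => np; apply: nle.
apply: chain_le => x y [sx _] [sy _]; apply: contrapT => nxy.
by apply: np; exists (x, y).
Qed.

(* The sets [B i] are closed under predecessors, and [B i] is obtained from
   the union of the previous ones by adding the minimal remaining heavy nodes
   above [s] together with a splitting of each of them. As all [B i] together
   have size at most [kappa], some [t] above [s] avoids them; below [t] there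
   is a new node in each [B i], and it splits off [t] inside [B i]. *)
Lemma heavy_wide (s : T) : heavy s -> exists a : kappa -> T,
  (forall i, (s <= a i)%O) /\ forall i j, (a i <= a j)%O -> i = j.
Proof.
move=> hs; pose H := above s `&` [set t | heavy t].
have /choice[p pP] (x : T) : exists p : T * T, heavy x ->
    [/\ (x <= p.1)%O, (x <= p.2)%O & ~ ((p.1 <= p.2)%O \/ (p.2 <= p.1)%O)].
  have [/heavy_split[p pP]|nx] := pselect (heavy x); first by exists p.
  by exists (x, x).
pose new C := minimals (H `\` C).
pose step C := \bigcup_(y in C `|`
  ([set (p x).1 | x in new C] `|` [set (p x).2 | x in new C])) below y.
have [B BE] := @wo_set_rec kappa T step.
pose C i := \bigcup_(j in [set j | wo_lt j i]) B j.
have Ble : forall i, small (B i).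
  apply: (well_founded_ind (@wo_lt_wf kappa)) => i IH.
  rewrite BE; apply: down_closure_le; apply: card_le_setU => //.
    apply: card_le_bigcup => //.
    by apply: card_le_trans (card_lexx setT); apply: subset_card_le.
  by apply: card_le_setU => //; apply: card_le_trans (card_image_le _ _) _;
    apply: minimals_le.
have Bdown i x y : (x <= y)%O -> B i y -> B i x.
  rewrite BE => xy [z Cz yz]; exists z => //.
  exact: Order.POrderTheory.le_trans xy yz.
have [t [Ht nBt]] : exists t, H t /\ forall i, ~ B i t.
  apply: contrapT => nt; apply: (heavy_above hs).
  apply: (@card_le_trans _ _ _ (\bigcup_(i in setT) B i)); last exact: card_le_bigcup.
  apply: subset_card_le => t Ht; apply: contrapT => nBt.
  by apply: nt; exists t; split=> // i Bit; apply: nBt; exists i.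
(* Nodes below [t] are comparable, so one of the two nodes splitting the new node [m] is not below
   [t]; it becomes the second component. *)
have /choice[w wP] i : exists q : T * T,
    [/\ new (C i) q.1, (q.1 <= t)%O, (q.1 <= q.2)%O, B i q.2 & ~ (q.2 <= t)%O].
  have [|m mnew mt] := @minimals_below (H `\` C i) t.
    by split=> // -[j _ /nBt].
  have [mu mv muv] : [/\ (m <= (p m).1)%O, (m <= (p m).2)%O &
      ~ (((p m).1 <= (p m).2)%O \/ ((p m).2 <= (p m).1)%O)].
    by apply: pP; case: mnew => -[[]].
  have [ut|nut] := pselect (((p m).1 <= t)%O).
    have [vt|nvt] := pselect (((p m).2 <= t)%O).
      by case: muv; apply: tree_comparable vt.
    exists (m, (p m).2); split=> //=; rewrite BE; exists (p m).2.
      by right; right; exists m.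
    exact: Order.POrderTheory.lexx.
  exists (m, (p m).1); split=> //=; rewrite BE; exists (p m).1.
    by right; left; exists m.
  exact: Order.POrderTheory.lexx.
have fresh i j x : wo_lt j i -> ((w i).1 <= x)%O -> ~ B j x.
  move=> ji mx Bjx; have [[[_ nC] _] _ _ _ _] := wP i.
  by apply: nC; exists j => //; apply: Bdown Bjx.
exists (fun i => (w i).2); split=> [i|i j wij].
  have [[[[sm _] _] _] _ mw _ _] := wP i.
  exact: Order.POrderTheory.le_trans sm mw.
have [_ mit mwi Bwi nwi] := wP i; have [_ mjt mwj Bwj nwj] := wP j.
(* For [i] before [j], the node [(w i).2] is comparable with the new node [(w j).1]: lying below it
   puts [(w i).2] below [t], lying above it contradicts [fresh]. For [j] before [i], [(w j).2] lies
   above [(w i).1], again against [fresh]. *)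
apply: contrapT => /wo_neq_lt[ij|ji].
  have [wm|mw] := tree_comparable wij mwj; last exact: (fresh j i _ ij mw Bwi).
  by apply: nwi; apply: Order.POrderTheory.le_trans wm mjt.
apply: (fresh i j _ ji _ Bwj).
exact: Order.POrderTheory.le_trans mwi wij.
Qed.

(** [L] collects the exceptions: nodes that are not heavy, nodes below a minimal member of some
    [N k], and nodes of [Q k] in [N k]. It has size at most [kappa], so what is left of [X] is no
    antichain and contains some [s] strictly below some [t]. *)
Lemma exists_dense_pair (X : set T) (Q : kappa -> set T) : ~ small X ->
  exists s t, [/\ X s, X t, heavy s, s <> t &
    forall k a, Q k t -> (s <= a)%O -> ~ small (Q k `&` above a)].
Proof.
move=> Xnle.
pose N k := [set u | small (Q k `&` above u)].
have Nup k u v : N k u -> (u <= v)%O -> N k v.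
  move=> Nu uv; apply: card_le_trans Nu; apply: subset_card_le => x [Qx vx].
  by split=> //; apply: Order.POrderTheory.le_trans uv vx.
pose B := \bigcup_(a in \bigcup_(k in setT) minimals (N k)) below a.
pose Y := \bigcup_(k in setT) (Q k `&` N k).
pose L := ~` [set s | heavy s] `|` (B `|` Y).
have Lle : small L.
  apply: card_le_setU => //; first exact: heavy_setC_le.
  apply: card_le_setU => //; last by apply: card_le_bigcup => // k _; exact: light_le.
  by apply: down_closure_le; apply: card_le_bigcup => // k _; apply: minimals_le.
have XLnle : ~ small (X `\` L).
  move=> le; apply: Xnle; apply: card_le_trans (card_le_setU kappa_inf le Lle).
  by apply: subset_card_le => x Xx; have [Lx|nLx] := pselect (L x); [right|left].
have [s [t [[Xs nLs] [Xt nLt] st sDt]]] :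
    exists s t, [/\ (X `\` L) s, (X `\` L) t, (s <= t)%O & s <> t].
  apply: contrapT => nst; apply: XLnle; apply: antichain_le => x y Xx Xy xy.
  by apply: contrapT => xDy; apply: nst; exists x, y.
exists s, t; split=> //; first by apply: contrapT => ns; apply: nLs; left.
(* A minimal [m] of [N k] below [a] is comparable with [s]: either [s] is below [m] and lies in [B],
   or [m] is below [t] and [t] lies in [Y]. *)
move=> k a Qt sa Na; have [m mN ma] := @minimals_below (N k) a Na.
have [sm|ms] := tree_comparable sa ma.
  by apply: nLs; right; left; exists m => //; exists k.
apply: nLt; right; right; exists k => //; split=> //.
by case: mN => Nm _; apply: Nup Nm _; apply: Order.POrderTheory.le_trans ms st.
Qed.

End ThinTree.

(** * The colouring *)

Section SuslinColouring.
Variables (kappa kappa_succ lambda : wotype) (d : Order.disp_t) (T : porderType d).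
Hypothesis kappa_inf : [set: nat] #<= [set: kappa].
Hypothesis kappa_succP : is_succ_cardinal kappa kappa_succ.
Hypothesis T_suslin : suslin_tree kappa_succ T.

(** A subset of [T] larger than [kappa] already has the full size of [kappa_succ]. *)
Lemma suslin_card_le (A : set T) :
  ~ (A #= [set: kappa_succ]) -> A #<= [set: kappa].
Proof.
move=> nA; apply: contrapT => /(succ_card_le kappa_succP) le.
have [_ /card_eqPle[TS _] _ _] := T_suslin.
apply: nA; apply/card_eqPle; split=> //.
by apply: card_le_trans TS; apply: subset_card_le.
Qed.

Lemma suslin_chain_le (C : set T) :
  (forall x y, C x -> C y -> (x <= y)%O \/ (y <= x)%O) -> C #<= [set: kappa].
Proof.
move=> Cchain; have [_ _ nchain _] := T_suslin.
pose C' : {pred T} := fun x => `[< C x >].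
have CC' : [set` C'] = C by apply/seteqP; split=> x /asboolP.
apply: suslin_card_le; rewrite -CC'; apply: nchain.
by move=> x y /asboolP Cx /asboolP Cy; apply/orP/Cchain.
Qed.

Lemma suslin_antichain_le (A : set T) :
  (forall x y, A x -> A y -> (x <= y)%O -> x = y) -> A #<= [set: kappa].
Proof.
move=> Aanti; have [_ _ _ nanti] := T_suslin.
pose A' : {pred T} := fun x => `[< A x >].
have AA' : [set` A'] = A by apply/seteqP; split=> x /asboolP.
apply: suslin_card_le; rewrite -AA'; apply: nanti.
move=> x y /asboolP Ax /asboolP Ay /orP[xy|yx]; first exact: Aanti.
by apply/esym/Aanti.
Qed.

Variables (g : kappa_succ -> T) (F : kappa_succ -> lambda -> kappa).
Variables (code : lambda -> (lambda -> kappa) -> kappa) (a : T -> kappa -> T).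
Hypothesis g_inj : injective g.
Hypothesis F_inj : injective F.
Hypothesis codeP : forall delta delta' f f', code delta f = code delta' f' <->
  delta = delta' /\ forall eps, wo_le eps delta -> f eps = f' eps.
Hypothesis aP : forall s, heavy kappa s ->
  (forall i, (s <= a s i)%O) /\ forall i j, (a s i <= a s j)%O -> i = j.

(** Heaviness of [g x] is included because [aP] provides the antichain [a (g x)] only above heavy
    nodes. *)
Definition edge_at (x y : kappa_succ) (delta : lambda) : Prop :=
  [/\ heavy kappa (g x), forall eps, wo_lt eps delta -> F x eps = F y eps,
      F x delta <> F y delta & (a (g x) (code delta (F y)) <= g y)%O].

Definition suslin_colour (p : upair kappa_succ) : bool :=
  `[< exists x y delta,
      [/\ sval p = [set x; y], wo_lt x y & edge_at x y delta] >].

(** The colour sees only the unordered pair; [wo_lt] rules out that its witnesses are [x] and [y]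
    swapped. *)
Lemma colour_edge (x y : kappa_succ) (X : set kappa_succ) :
  homogeneous suslin_colour X true -> X x -> X y -> wo_lt x y ->
  exists delta, edge_at x y delta.
Proof.
move=> Xhom Xx Xy xy.
have xyU : exists x' y', x' <> y' /\ [set x; y] = [set x'; y'].
  by exists x, y; split=> //; apply: wo_lt_neq.
have /asboolP[x' [y' [delta [/= E x'y' edge]]]] :
    suslin_colour (exist _ [set x; y] xyU).
  by apply: Xhom => _ [->|->].
have x'E : x' = x \/ x' = y by have : [set x; y] x' by rewrite E; left.
have y'E : y' = x \/ y' = y by have : [set x; y] y' by rewrite E; right.
exists delta; move: x'E y'E x'y' edge => [->|->] [->|->] //.
- by move=> /wo_ltxx.
- by move=> yx; have /wo_ltxx := wo_lt_trans xy yx.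
- by move=> /wo_ltxx.
Qed.

(* Both codes label nodes below [g z] in the antichain chosen for [g x], so
   they are equal; hence [F y] and [F z] agree up to [delta]. *)
Lemma edge_at_lt (x y z : kappa_succ) (delta delta' delta'' : lambda) :
  edge_at x y delta -> edge_at x z delta' -> edge_at y z delta'' ->
  delta' = delta /\ wo_lt delta delta''.
Proof.
move=> [hx _ _ axy] [_ _ _ axz] [hy _ Fyz ayz].
have [T_tree _ _ _] := T_suslin.
have [_ ax_inj] := aP hx; have [ay_ge _] := aP hy.
have axyz : (a (g x) (code delta (F y)) <= g z)%O.
  apply: Order.POrderTheory.le_trans axy _.
  exact: Order.POrderTheory.le_trans (ay_ge _) ayz.
have /codeP[<- Feq] : code delta (F y) = code delta' (F z).
  by have [/ax_inj//|/ax_inj/esym] := tree_comparable T_tree axyz axz.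
split=> //; apply/negP => /Feq; exact: Fyz.
Qed.

Lemma no_false_homogeneous (X : set kappa_succ) :
  ~ (X #<= [set: kappa]) -> ~ homogeneous suslin_colour X false.
Proof.
move=> Xnle Xhom; have [T_tree _ _ _] := T_suslin.
have gXnle : ~ (g @` X #<= [set: kappa]).
  move=> le; apply: Xnle; apply: card_le_trans le.
  apply: (@fun_card_le _ _ _ _ g) => [x Xx|x y _ _]; first by exists x.
  exact: g_inj.
pose Q k : set T :=
  [set t | exists z delta, [/\ X z, t = g z & code delta (F z) = k]].
have [_ [_ [[x Xx <-] [y Xy <-] hx gxy dense]]] :=
  exists_dense_pair kappa_inf T_tree suslin_chain_le suslin_antichain_le Q gXnle.
have [|delta [Fxy /= deltamin]] := @wo_min lambda (fun e => F x e <> F y e).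
  apply: contrapT => nF; apply: gxy; congr g; apply: F_inj.
  by apply/funext => e; apply: contrapT => Fe; apply: nF; exists e.
have [ax_ge ax_inj] := aP hx.
set k := code delta (F y).
have Qk : ~ (Q k `&` above (a (g x) k) #<= [set: kappa]).
  by apply: dense => //; exists y, delta.
(* At most [kappa] points are at or before [x], too few to account for all nodes with code [k] above
   [a (g x) k]. *)
have [z [delta' [Xz codez axz xz]]] : exists z delta',
    [/\ X z, code delta' (F z) = k, (a (g x) k <= g z)%O & wo_lt x z].
  apply: contrapT => nz; apply: Qk.
  apply: (@card_le_trans _ _ _ (g @` ([set z | wo_lt z x] `|` [set x]))).
    apply: subset_card_le => _ [[z [delta' [Xz -> codez]]] axz].
    exists z => //; have [zx|xz] := wo_leVlt z x.
      have [->|/wo_neq_lt[zx'|/negP//]] := pselect (z = x); first by right.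
      by left.
    by case: nz; exists z, delta'.
  apply: card_le_trans (card_image_le _ _) _.
  apply: card_le_setU => //; first exact: succ_segment_le.
  by apply: (@fun_card_le _ _ _ _ (fun=> k)) => // u v -> ->.
(* Equal codes make [F z] agree with [F y] through [delta], so [delta] is also the first difference
   of [F x] and [F z]. *)
have /codeP[dE Fzy] := codez; rewrite dE in codez Fzy.
have xzU : exists x' y', x' <> y' /\ [set x; z] = [set x'; y'].
  by exists x, z; split=> //; apply: wo_lt_neq.
have : suslin_colour (exist _ [set x; z] xzU) = false.
  by apply: Xhom => _ [->|->].
move=> /negP; apply; apply/asboolP; exists x, z, delta; split=> //; split=> //.
- move=> e ed; rewrite Fzy; last exact: wo_ltW.
  by apply: contrapT => /deltamin; apply/negP.
- by rewrite Fzy //; apply: wo_refl.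
- by rewrite codez.
Qed.

(** Let [u] and [v] be the two points after [lambda]. By [edge_at_lt], the first differences [D xi]
    with [u] increase strictly and stay below the first difference [top] of [u] and [v]; but an
    increasing map cannot move [top] down. *)
Lemma no_true_homogeneous (X : set kappa_succ) :
  has_order_type X (wo_add lambda (wo_ord 2)) ->
  ~ homogeneous suslin_colour X true.
Proof.
move=> [h [hmono hX]] Xhom.
have edge i j : wo_lt i j -> exists delta, edge_at (h i) (h j) delta.
  move=> ij; apply: (colour_edge Xhom); [by rewrite -hX; exists i| |].
    by rewrite -hX; exists j.
  by rewrite /wo_lt hmono.
pose u : wo_add lambda (wo_ord 2) := inr (@Ordinal 2 0 isT).
pose v : wo_add lambda (wo_ord 2) := inr (@Ordinal 2 1 isT).
pose inj xi : wo_add lambda (wo_ord 2) := inl xi.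
have [top topP] : exists delta, edge_at (h u) (h v) delta by apply: edge.
have /choice[D DP] xi : exists delta, edge_at (h (inj xi)) (h u) delta.
  exact: edge.
have Dtop xi : wo_lt (D xi) top.
  have [delta uv] : exists delta, edge_at (h (inj xi)) (h v) delta by apply: edge.
  by have [_] := edge_at_lt (DP xi) uv topP.
have Dlt xi eta : wo_lt xi eta -> wo_lt (D xi) (D eta).
  move=> lt; have [delta e] : exists delta, edge_at (h (inj xi)) (h (inj eta)) delta.
    exact: edge.
  by have [->] := edge_at_lt e (DP xi) (DP eta).
have := wo_homo_ge Dlt top; apply/negP; exact: Dtop.
Qed.

End SuslinColouring.

Unset Implicit Arguments.

Theorem theorem3p7 (kappa kappa_succ lambda : wotype)
    (kappa_card : is_cardinal kappa)
    (kappa_inf : [set: nat] #<= [set: kappa])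
    (kappa_succP : is_succ_cardinal kappa kappa_succ)
    (lambdaP : is_log_succ kappa lambda)
    (suslinP : exists (d : Order.disp_t) (T : porderType d),
        suslin_tree kappa_succ T) :
  ~ arrows kappa_succ kappa_succ (wo_add lambda (wo_ord 2)).
Proof.
have [d [T Tsus]] := suslinP.
have [T_tree /card_eqPle[_ ST] _ _] := Tsus.
have chain_le := suslin_chain_le kappa_succP Tsus.
have antichain_le := suslin_antichain_le kappa_succP Tsus.
have [k0 _] := infinite_inhabited kappa_inf.
have [x0 _] : exists x0 : kappa_succ, True.
  apply: contrapT => nx; apply: (succ_not_le kappa_succP).
  by apply: (@fun_card_le _ _ _ _ (fun=> k0)) => // x; case: nx; exists x.
have [_ [/(_ x0 I)[t0 _] _ _]] := card_leE ST.
have [g ginj] := card_le_fun t0 ST.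
have [F Finj] := card_le_fun (fun=> k0) (succ_le_functions kappa_succP lambdaP).
have [code codeP] := restriction_code kappa_inf lambdaP.
have /choice[a aP] (s : T) : exists a : kappa -> T, heavy kappa s ->
    (forall i, (s <= a i)%O) /\ forall i j, (a i <= a j)%O -> i = j.
  have [hs|ns] := pselect (heavy kappa s); last by exists (fun=> t0).
  by have [a aP] := heavy_wide kappa_inf T_tree chain_le antichain_le hs; exists a.
have g_inj : injective g by move=> x y; apply: ginj.
have F_inj : injective F by move=> x y; apply: Finj.
move=> /(_ (suslin_colour g F code a)) [[X [[f [fmono fX]] Xhom]]|[X [Xtype Xhom]]].
  apply: (no_false_homogeneous kappa_inf kappa_succP Tsus g_inj F_inj codeP aP _ Xhom).
  move=> XK; apply: (succ_not_le kappa_succP); apply: card_le_trans XK.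
  (* The order embedding [f] is injective, so [X] is as large as [kappa_succ]. *)
  apply: (@fun_card_le _ _ _ _ f) => [x _|x y _ _ fE].
    by rewrite -fX; exists x.
  by apply: wo_anti; rewrite -fmono fE wo_refl.
exact: (no_true_homogeneous Tsus codeP aP Xtype Xhom).
Qed.
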